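(* Let $s\in\mathcal{S}_{Conf}$ be a configuration of the Rubik's Revenge, described by the $5$-tuple $(\sigma,\tau,\rho,x,y)$ with $\sigma\in S_8$, $\tau\in S_{24}$, $\rho\in S_{24}$, $x\in(\mathbb{Z}_3)^8$, $y\in(\mathbb{Z}_2)^{24}$. Then $(\sigma,\tau,\rho,x,y)$ is valid if and only if all of the following hold: 1. $\mathrm{sgn}(\sigma)=\mathrm{sgn}(\rho)$; 2. $\sum_{i=1}^{8}x_i\equiv 0 \pmod 3$; 3. $y_{i_{t,s}}=1-\delta_{t,s}$ for all $i=1,\dots,12$ and both $t\in\{a,b\}$, where $s\in\{a,b\}$ is the type of the edge cubie occupying position $i_t$, $y_{i_{t,s}}:=y_{i_t}$, and $\delta_{a,a}=\delta_{b,b}=1$, $\delta_{a,b}=\delta_{b,a}=0$.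
   Context: Geometry. The Rubik's Revenge is the $4\times4\times4$ cube. Its $56$ visible cubies occupy the positions $p\in\{-3,-1,1,3\}^3$ having at least one coordinate equal to $\pm3$: $8$ corner positions (three coordinates $\pm3$), $24$ edge positions (exactly two), $24$ center positions (exactly one). A facelet is a pair $(p,n)$ with $p$ a position and $n\in\{\pm e_1,\pm e_2,\pm e_3\}$ an outward unit normal with $p\cdot n=3$; there are $96$ facelets. The faces right, left, back, front, up, down have normals $e_1,-e_1,e_2,-e_2,e_3,-e_3$, and in the solved cube they are coloured blue, green, orange, red, white, yellow respectively. Each sticker is identified with the facelet it occupies in the solved (and labelled) cube, its home facelet; each cubie is identified with its home position. Moves. The group of moves $\mathbf{M}$ is generated by the twelve clockwise quarter turns $R,L,F,B,U,D$ (external slices) and $C_R,C_L,C_F,C_B,C_U,C_D$ (central slices). The external turn of the face with normal $n$ applies to all facelets $(p,m)$ with $p\cdot n=3$ the rotation by $90^\circ$ about $n$, clockwise when viewed from outside that face (acting on both $p$ and $m$), and fixes the other facelets. The corresponding central turn does the same to all facelets with $p\cdot n=1$. $\mathbf{G}\subset\mathbf{S}_{96}$ is the group of permutations of the $96$ facelets generated by these moves. Configurations. $\mathcal{S}_{Conf}\subset \mathbf{S}_{96}$ is the set of all permutations and/or orientation changes of corner, edge and center cubies: permutations $s$ of the facelets ($s(f)$ being the facelet currently occupied by the sticker with home $f$) such that, for each position $p$, $s$ maps the facelets of $p$ onto the facelets of a position $p'$ of the same kind (corner, edge or center), and for corners respects the clockwise cyclic order of the three facelets. All such $s$ are allowed,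 including flips of a single edge cubie, so $|\mathcal{S}_{Conf}|=(24!)^2\cdot2^{24}\cdot3^8\cdot8!$. $\mathbf{G}$ acts on $\mathcal{S}_{Conf}$ on the left by composition, $g\cdot s=g\circ s$. The $5$-tuple. A configuration is identified with $(\sigma,\tau,\rho,x,y)$: $\sigma,\tau,\rho$ are the permutations of the $8$ corner, $24$ edge and $24$ center positions, respectively, sending a cubie's home position to its current position. Corner orientation: on each corner cubie, the white or yellow sticker has number $0$ and the other two stickers have numbers $1,2$, proceeding clockwise around the corner from sticker $0$ (viewed from outside). Corner positions are numbered $1,\dots,8$; $x_i\in\mathbb{Z}_3$ is the number of the sticker lying on the up or down face of the corner in position $i$. Edge positions and orientation: the $24$ edge positions come in $12$ pairs (the two positions in a pair lie between the same two faces), numbered $i=1,\dots,12$; the members of pair $i$ are denoted $i_a$ and $i_b$. The reference facelet of an edge position is the one on the up or down face if there is one, and otherwise the one on the front or back face. If the reference facelet of an edge position $p$ has normal $n$ and its other facelet has normal $n'$, then $p$ is an $a$-position if $\det(n,n',p)=1$ and a $b$-position if $\det(n,n',p)=-1$; each pair contains exactly one of each. An edge cubie is of type $a$ (resp. type $b$) if its home position is an $a$-position (resp. $b$-position). On an edge cubie having a white or yellow sticker, that sticker has number $0$ and the other has number $1$; on the remaining edge cubies, the red or orange sticker has number $0$ and the green or blue sticker has number $1$. $y_{i_t}\in\mathbb{Z}_2$ is the number of the sticker lying on the reference facelet of position $i_t$, and $y=(y_{1_a},\dots,y_{12_a},y_{1_b},\dots,y_{12_b})$. Validity. The initial configuration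 is $(id_{S_8},id_{S_{24}},id_{S_{24}},0,0)$ (the identity of $\mathbf{S}_{96}$). A configuration is valid if it lies in the orbit of the initial configuration under the action of $\mathbf{G}$. *)

(* Defs.v *)
From mathcomp Require Import all_boot all_order all_algebra all_fingroup ring.

Set Implicit Arguments.
Unset Strict Implicit.
Unset Printing Implicit Defensive.

Import Order.TTheory GRing.Theory Num.Theory.
Local Open Scope ring_scope.

Notation vec := (int * int * int)%type.

Definition e1 : vec := (1, 0, 0).
Definition e2 : vec := (0, 1, 0).
Definition e3 : vec := (0, 0, 1).

Definition dot (u v : vec) : int :=
  u.1.1 * v.1.1 + u.1.2 * v.1.2 + u.2 * v.2.

Definition cross (u v : vec) : vec :=
  (u.1.2 * v.2 - u.2 * v.1.2,
   u.2 * v.1.1 - u.1.1 * v.2,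
   u.1.1 * v.1.2 - u.1.2 * v.1.1).

(* The determinant in computable form; [det3E] relates it to [\det]. *)
Definition det3 (u v w : vec) : int := dot u (cross v w).

Definition row_of (u : vec) : 'rV[int]_3 :=
  \row_(j < 3) [:: u.1.1; u.1.2; u.2]`_j.

Lemma det3E (u v w : vec) :
  det3 u v w =
  \det (\matrix_(i < 3, j < 3) [:: row_of u; row_of v; row_of w]`_i 0 j).
Proof.
rewrite (expand_det_row _ ord0) !big_ord_recl big_ord0 /cofactor.
rewrite !(expand_det_row _ ord0) !big_ord_recl !big_ord0 /cofactor !det_mx11.
do 5 rewrite ?mxE /=.
by rewrite /det3 /dot /cross /bump /=; ring.
Qed.

Definition coords : seq int := [:: -3; -1; 1; 3].

Definition cube : seq vec :=
  [seq (ab, c) | ab <- [seq (a, b) | a <- coords, b <- coords], c <- coords].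

Definition outer (p : vec) : nat :=
  count (fun c : int => `|c| == 3) [:: p.1.1; p.1.2; p.2].

Definition positions : seq vec := [seq p <- cube | (0 < outer p)%N].
Definition corners : seq vec := [seq p <- positions | outer p == 3].
Definition edges : seq vec := [seq p <- positions | outer p == 2].
Definition centers : seq vec := [seq p <- positions | outer p == 1].

Definition normals : seq vec := [:: e1; - e1; e2; - e2; e3; - e3].

Definition facelets : seq (vec * vec) :=
  [seq f <- [seq (p, n) | p <- positions, n <- normals] | dot f.1 f.2 == 3].

Definition position : finType := seq_sub positions.
Definition corner : finType := seq_sub corners.
Definition edge : finType := seq_sub edges.
Definition center : finType := seq_sub centers.
Definition normal : finType := seq_sub normals.
Definition facelet : finType := seq_sub facelets.

Definition fpos (f : facelet) : vec := (val f).1.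
Definition fnormal (f : facelet) : vec := (val f).2.

(* Rotation by a quarter turn about the unit vector [n], clockwise when looking
   from the tip of [n] towards the origin: v |-> (v . n) n + v x n. *)
Definition rot (n v : vec) : vec := n *~ dot v n + cross v n.

(* [central] selects the layer p . n = 1, otherwise it is p . n = 3. *)
Definition depth (central : bool) : int := if central then 1 else 3.

Definition turn_raw (n : vec) (central : bool) (f : vec * vec) : vec * vec :=
  if dot f.1 n == depth central then (rot n f.1, rot n f.2) else f.

Lemma turn_rawP (n : normal) (central : bool) (f : facelet) :
  turn_raw (val n) central (val f) \in facelets.
Proof.
have H : all (fun n => all (fun f => (turn_raw n true f \in facelets)
    && (turn_raw n false f \in facelets)) facelets) normals by vm_compute.
have /allP/(_ _ (valP f))/andP[] := allP H _ (valP n).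
by case: central.
Qed.

Definition turn_fun (n : normal) (central : bool) (f : facelet) : facelet :=
  SeqSub (turn_rawP n central f).

Lemma turn_fun_inj (n : normal) (central : bool) :
  injective (turn_fun n central).
Proof.
have H : all (fun n => all (fun c => all (fun f =>
    iter 4 (turn_raw n c) f == f) facelets) [:: true; false]) normals
  by vm_compute.
apply: (@can_inj _ _ _ (iter 3 (turn_fun n central))) => f.
have /allP/(_ central) := allP H _ (valP n).
rewrite !inE; case: central => /(_ isT)/allP/(_ _ (valP f))/eqP Hf;
by apply: val_inj; rewrite -[RHS]Hf.
Qed.

Definition turn (n : normal) (central : bool) : {perm facelet} :=
  perm (@turn_fun_inj n central).

Definition G : {group {perm facelet}} :=
  <<[set turn nc.1 nc.2 | nc : normal * bool]>>%G.

Definition facelets_at (p : vec) : {set facelet} := [set f | fpos f == p].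

(* For outward normals m, m' at a corner position p: m' comes next after m,
   clockwise as viewed from outside (e1, e2, e3 are counterclockwise at
   (3, 3, 3)). *)
Definition clockwise (p m m' : vec) : bool := det3 m m' p < 0.

Definition same_kind_onto (s : {perm facelet}) : bool :=
  [forall p : position, exists p' : position,
     (outer (val p) == outer (val p')) &&
     (s @: facelets_at (val p) == facelets_at (val p'))].

Definition respects_clockwise (s : {perm facelet}) : bool :=
  [forall f : facelet, forall g : facelet,
     [&& fpos f \in corners, fpos g == fpos f
       & clockwise (fpos f) (fnormal f) (fnormal g)] ==>
     clockwise (fpos (s f)) (fnormal (s f)) (fnormal (s g))].

Definition S_Conf : {set {perm facelet}} :=
  [set s | same_kind_onto s && respects_clockwise s].

(* In [{perm facelet}], (s * g) f = g (s f): the right regular action ['R] of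
   MathComp sends s to the composite g o s. *)
Definition valid (s : {perm facelet}) : bool := s \in orbit 'R G 1%g.

Variant colour := Blue | Green | Orange | Red | White | Yellow.

Definition colour_of (n : vec) : colour :=
  if n == e1 then Blue else if n == - e1 then Green
  else if n == e2 then Orange else if n == - e2 then Red
  else if n == e3 then White else Yellow.

Definition white_yellow (c : colour) : bool :=
  match c with White | Yellow => true | _ => false end.

Definition red_orange (c : colour) : bool :=
  match c with Red | Orange => true | _ => false end.

Definition normals_at (p : vec) : seq vec := [seq n <- normals | dot p n == 3].

(* Sticker numbers are functions of the home facelet; [corner_number] and
   [edge_number] are meaningful on corner and edge facelets respectively. *)
Definition corner_number (f : facelet) : 'Z_3 :=
  let: (p, n) := val f in
  if white_yellow (colour_of n) then 0
  else if has (fun m => white_yellow (colour_of m) && clockwise p m n)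
              (normals_at p)
  then 1 else 2.

Definition edge_number (f : facelet) : 'Z_2 :=
  let: (p, n) := val f in
  if has (fun m => white_yellow (colour_of m)) (normals_at p)
  then (if white_yellow (colour_of n) then 0 else 1)
  else (if red_orange (colour_of n) then 0 else 1).

Definition up_down (n : vec) : bool := (n == e3) || (n == - e3).
Definition front_back (n : vec) : bool := (n == e2) || (n == - e2).

(* Whether the facelet (p, n) of the edge position p is its reference one. *)
Definition is_reference (p n : vec) : bool :=
  if has up_down (normals_at p) then up_down n else front_back n.

Variant edge_type := type_a | type_b.

Definition type_of (p : vec) : edge_type :=
  if has (fun n => is_reference p n &&
       has (fun n' => (n' != n) && (det3 n n' p == 1)) (normals_at p))
     (normals_at p)
  then type_a else type_b.

Lemma type_ofP (p n n' : vec) :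
  p \in edges -> n \in normals_at p -> n' \in normals_at p -> n' != n ->
  is_reference p n ->
  det3 n n' p = (if type_of p is type_a then 1 else -1).
Proof.
have H : all (fun p => all (fun n => all (fun n' =>
    (n' != n) ==> is_reference p n ==>
    (det3 n n' p == (if type_of p is type_a then 1 else -1)))
  (normals_at p)) (normals_at p)) edges by vm_compute.
move=> /(allP H)/allP Hp /Hp/allP Hn /Hn + nn' ref.
by rewrite nn' ref => /eqP.
Qed.

Definition delta (t s : edge_type) : 'Z_2 :=
  match t, s with
  | type_a, type_a | type_b, type_b => 1
  | _, _ => 0
  end.

(* [x] and [y] are indexed by the positions themselves rather than by a
   numbering of them; the edge position [p] is the one written i_t with
   t = [type_of p].  The sticker lying on the facelet f is the one with home
   s^-1 f. *)
Definition described (s : {perm facelet}) (sigma : {perm corner})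
    (tau : {perm edge}) (rho : {perm center})
    (x : {ffun corner -> 'Z_3}) (y : {ffun edge -> 'Z_2}) : Prop :=
  [/\ forall (c : corner) (f : facelet),
        fpos f = val c -> fpos (s f) = val (sigma c),
      forall (c : edge) (f : facelet),
        fpos f = val c -> fpos (s f) = val (tau c),
      forall (c : center) (f : facelet),
        fpos f = val c -> fpos (s f) = val (rho c),
      forall (c : corner) (f : facelet),
        fpos f = val c -> up_down (fnormal f) ->
        x c = corner_number ((s^-1)%g f)
    & forall (c : edge) (f : facelet),
        fpos f = val c -> is_reference (val c) (fnormal f) ->
        y c = edge_number ((s^-1)%g f)].

Lemma kind_perm (k : nat) (s : {perm facelet}) :
  s \in S_Conf ->
  exists pi : {perm seq_sub [seq p <- positions | outer p == k]},
    forall c f, fpos f = val c -> fpos (s f) = val (pi c).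
Proof.
rewrite inE => /andP[/forallP sk _].
have H : all (fun p => has (fun f => f.1 == p) facelets) positions.
  by vm_compute.
have Hf p : p \in positions -> exists f : facelet, fpos f = p.
  by move=> /(allP H)/hasP[f fF /eqP <-]; exists (SeqSub fF).
have skv p : p \in positions -> exists p', [/\ p' \in positions,
    outer p = outer p' & s @: facelets_at p = facelets_at p'].
  move=> pP; have /existsP[p' /andP[/eqP kk /eqP e]] := sk (SeqSub pP).
  exists (ssval p'); split; [exact: ssvalP | exact: kk | exact: e].
set T := seq_sub _.
have im (c : T) : exists c' : T,
    s @: facelets_at (val c) = facelets_at (val c').
  have := ssvalP c; rewrite mem_filter => /andP[/eqP kc cP].
  have [p' [p'P kk e]] := skv _ cP.
  have p'L : p' \in [seq p <- positions | outer p == k].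
    by rewrite mem_filter -kk kc eqxx.
  exists (SeqSub p'L); exact: e.
have im' (c : T) : exists c' : T,
    s @: facelets_at (val c) == facelets_at (val c').
  by have [c' ->] := im c; exists c'.
pose h c := xchoose (im' c).
have hP c : s @: facelets_at (val c) = facelets_at (val (h c)).
  exact/eqP/(xchooseP (im' c)).
have h_inj : injective h.
  move=> c c' e; have := hP c; rewrite e -hP => /(imset_inj (@perm_inj _ s)).
  move=> /setP E; apply: val_inj.
  have := valP c; rewrite mem_filter => /andP[_ /Hf[f fc]].
  by have := E f; rewrite !inE fc eqxx => /esym/eqP.
exists (perm h_inj) => c f fc; rewrite permE.
have : s f \in facelets_at (val (h c)).
  by rewrite -hP imset_f // inE fc.
by rewrite inE => /eqP.
Qed.

Lemma corner_facelet (c : corner) : exists f : facelet,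
  [/\ fpos f = val c, up_down (fnormal f) &
   forall g : facelet, fpos g = val c -> up_down (fnormal g) -> g = f].
Proof.
have H : all (fun p => has (fun f => [&& f.1 == p, up_down f.2 &
    all (fun g => (g.1 == p) ==> up_down g.2 ==> (g == f)) facelets])
  facelets) corners by vm_compute.
have /hasP[f fF /and3P[/eqP fc fu /allP u]] := allP H _ (valP c).
exists (SeqSub fF); split=> // g /eqP gc gu; apply/val_inj/eqP.
by have := u _ (valP g); rewrite -/(fpos g) gc -/(fnormal g) gu.
Qed.

Lemma edge_facelet (c : edge) : exists f : facelet,
  [/\ fpos f = val c, is_reference (val c) (fnormal f) &
   forall g : facelet, fpos g = val c ->
     is_reference (val c) (fnormal g) -> g = f].
Proof.
have H : all (fun p => has (fun f => [&& f.1 == p, is_reference p f.2 &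
    all (fun g => (g.1 == p) ==> is_reference p g.2 ==> (g == f)) facelets])
  facelets) edges by vm_compute.
have /hasP[f fF /and3P[/eqP fc fu /allP u]] := allP H _ (valP c).
exists (SeqSub fF); split=> // g /eqP gc gu; apply/val_inj/eqP.
by have := u _ (valP g); rewrite -/(fpos g) gc -/(fnormal g) gu.
Qed.

Lemma described_ex (s : {perm facelet}) :
  s \in S_Conf -> exists sigma tau rho x y, described s sigma tau rho x y.
Proof.
move=> sC.
have [sigma hs] := kind_perm 3 sC.
have [tau ht] := kind_perm 2 sC.
have [rho hr] := kind_perm 1 sC.
have hx : forall c : corner, exists z, forall f : facelet,
    fpos f = val c -> up_down (fnormal f) -> corner_number ((s^-1)%g f) == z.
  move=> c; have [f [_ _ u]] := corner_facelet c.
  by exists (corner_number ((s^-1)%g f)) => g gc gu; rewrite (u g gc gu).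
have hy : forall c : edge, exists z, forall f : facelet,
    fpos f = val c -> is_reference (val c) (fnormal f) ->
    edge_number ((s^-1)%g f) == z.
  move=> c; have [f [_ _ u]] := edge_facelet c.
  by exists (edge_number ((s^-1)%g f)) => g gc gu; rewrite (u g gc gu).
have [x xP] := fin_all_exists hx; have [y yP] := fin_all_exists hy.
exists sigma, tau, rho, [ffun c => x c], [ffun c => y c].
by split=> // c f fc fr; rewrite ffunE; apply/esym/eqP;
  [apply: xP | apply: yP].
Qed.

Lemma described_uniq (s : {perm facelet}) sigma tau rho x y
    sigma' tau' rho' x' y' :
  described s sigma tau rho x y -> described s sigma' tau' rho' x' y' ->
  [/\ sigma = sigma', tau = tau', rho = rho', x = x' & y = y'].
Proof.
move=> [h1 h2 h3 h4 h5] [h1' h2' h3' h4' h5'].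
split.
- apply/permP => c; have [f [fc _ _]] := corner_facelet c; apply: val_inj.
  by rewrite -(h1 _ _ fc) -(h1' _ _ fc).
- apply/permP => c; have [f [fc _ _]] := edge_facelet c; apply: val_inj.
  by rewrite -(h2 _ _ fc) -(h2' _ _ fc).
- have H : all (fun p => has (fun f => f.1 == p) facelets) centers.
    by vm_compute.
  apply/permP => c; have /hasP[f fF /eqP fc] := allP H _ (valP c).
  by apply: val_inj; rewrite -(h3 c (SeqSub fF) fc) -(h3' c (SeqSub fF) fc).
- apply/ffunP => c; have [f [fc fu _]] := corner_facelet c.
  by rewrite (h4 _ _ fc fu) (h4' _ _ fc fu).
- apply/ffunP => c; have [f [fc fu _]] := edge_facelet c.
  by rewrite (h5 _ _ fc fu) (h5' _ _ fc fu).
Qed.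

(* Main.v *)
Require Import Defs.
From mathcomp Require Import all_boot all_order all_algebra all_fingroup.

(** Let [spin] rotate the stickers of every cubie by one step. The configurations
    are the permutations commuting with [spin], so each of them permutes the
    cubies and twists them in place. Labelling the two stickers of an edge by the
    sign of det(n, n', p), every turn preserves labels on edges, adds no total
    twist on corners (mod 3), and changes the parities of corners and centers
    together; these are the three conditions, which gives one direction.

    Conversely, a commutator gives a 3-cycle (a b c) of cubies of each kind.
    Conjugating it by the turns that do not touch a and b carries the sticker of c
    to those of every other cubie, so all 3-cycles (a b c) are obtained, hence
    all even permutations. On corners c is also reached with every twist, and two
    3-cycles differing by a twist of c have a quotient twisting two corners in
    opposite directions. Finally, one central and one external turn correct the
    parities of the edges and of the corners and centers. *)

Set Implicit Arguments.
Unset Strict Implicit.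
Unset Printing Implicit Defensive.

Import GRing.Theory.
Local Open Scope ring_scope.

(** * Permutations *)

Definition swap (T : eqType) (x : T) (t : T * T) : T :=
  if x == t.1 then t.2 else if x == t.2 then t.1 else x.

(** A list of swaps of raw values certifies a permutation together with its parity, so that parities
    of turns can be settled by evaluation. *)
Lemma perm_of_swaps (T : choiceType) (l : seq T) (ts : seq (T * T)) :
  all (fun t => [&& t.1 \in l, t.2 \in l & t.1 != t.2]) ts ->
  exists2 q : {perm seq_sub l},
    odd_perm q = odd (size ts) & forall z, val (q z) = foldl (@swap T) (val z) ts.
Proof.
elim: ts => [_|[u v] ts IH /= /andP[/and3P[/= ul vl uv] /IH[q oq qE]]].
  by exists 1%g => [|z]; rewrite ?odd_perm1 ?perm1.
exists (tperm (SeqSub ul) (SeqSub vl) * q)%g => [|z].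
  by rewrite odd_permM odd_tperm oq -val_eqE uv.
rewrite permM qE /swap /=; congr (foldl _ _ _).
by case: tpermP => [->|->|/eqP + /eqP]; rewrite -?val_eqE /= ?eqxx //;
   [case: eqP|move=> /negPf-> /negPf->].
Qed.

(* Modulo the given 3-cycles every transposition [(a c)] is congruent to
   [(a b)], and the transpositions [(a c)] generate the symmetric group. *)
Lemma even_perm_in (T : finType) (H : {group {perm T}}) (a b : T) :
  b != a ->
  (forall c, c != a -> c != b -> (tperm a b * tperm a c)%g \in H) ->
  forall p : {perm T}, ~~ odd_perm p -> p \in H.
Proof.
move=> ba abcH p.
have step c : c != a -> (tperm a b * tperm a c)%g \in H.
  by move=> ca; have [->|] := eqVneq c b; [rewrite tperm2 group1|exact: abcH].
(* With the correcting factor (a b) for odd [p], the claim makes sense for all [p] and passes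
   through an induction on the number of transpositions. *)
suff: (p * tperm a b ^+ odd_perm p)%g \in H.
  by move=> + /negPf pe; rewrite pe expg0 mulg1.
have : p \in <<[set tperm a y | y in T]>>%g by rewrite gen_tperm inE.
case/gen_prodgP => n [t tP ->].
elim: n t tP => [|n IH] t tP.
  by rewrite big_ord0 odd_perm1 mulg1 group1.
rewrite big_ord_recr /=; set q := (\prod_(i < n) _)%g.
have qH : (q * tperm a b ^+ odd_perm q)%g \in H by apply: IH => i; exact: tP.
have /imsetP[c _ ->] := tP ord_max.
have [->|ca] := eqVneq c a; first by rewrite tperm1 mulg1.
rewrite odd_permM odd_tperm eq_sym ca addbT.
case: (odd_perm q) qH; rewrite ?expg0 ?expg1 ?mulg1 /= => qH.
  have -> : (q * tperm a c = q * tperm a b * (tperm a b * tperm a c))%g.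
    by rewrite !mulgA -(mulgA q) tperm2 mulg1.
  by rewrite groupM // step.
rewrite -mulgA groupM // -groupV invMg !tpermV; exact: step.
Qed.


(** * Sticker labels *)

(* Label 0 marks the sticker on an up or down face for corners, and the sticker
   with det(n, n', p) = 1 for edges; the moves preserve the latter. *)
Definition label (f : vec * vec) : nat :=
  let: (p, n) := f in
  if outer p == 3%N then
    if up_down n then 0%N
    else if has (fun m => up_down m && clockwise p m n) (normals_at p) then 1%N
    else 2%N
  else (outer p == 2%N) && has (fun m => det3 n m p == -1) (normals_at p).

(** The pair [(p, 0)] is a junk value, reached only if no facelet of [p] has label [i]. *)
Definition sticker (p : vec) (i : nat) : vec * vec :=
  let fs := [seq (p, n) | n <- normals_at p] in
  nth (p, 0) fs (find (fun f => label f == i) fs).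

(** The value [outer p] is also the number of stickers of the cubie at [p], so it serves as the
    modulus for labels. *)
Definition next_raw (f : vec * vec) : vec * vec :=
  sticker f.1 ((label f).+1 %% outer f.1)%N.

Lemma facelet_facts : all (fun f =>
  [&& next_raw f \in facelets, (next_raw f).1 == f.1,
      label (next_raw f) == ((label f).+1 %% outer f.1)%N,
      iter (outer f.1) next_raw f == f, (label f < outer f.1)%N,
      iter (label f) next_raw (sticker f.1 0) == f & f.1 \in positions]) facelets.
Proof. by vm_compute. Qed.

Lemma position_facts : all (fun p =>
  [&& sticker p 0 \in facelets, (sticker p 0).1 == p, label (sticker p 0) == 0%N
    & outer p \in [:: 1; 2; 3]%N]) positions.
Proof. by vm_compute. Qed.

Lemma facelet_all (P : pred (vec * vec)) :
  all P facelets -> forall f : facelet, P (val f).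
Proof. by move=> /allP H f; exact: H (valP f). Qed.


Local Opaque facelets positions normals.

Lemma next_rawP (f : facelet) : next_raw (val f) \in facelets.
Proof. by have /andP[] := facelet_all facelet_facts f. Qed.

Definition next (f : facelet) : facelet := SeqSub (next_rawP f).

Lemma next_facts (f : facelet) :
  [/\ fpos (next f) = fpos f,
      label (val (next f)) = ((label (val f)).+1 %% outer (fpos f))%N,
      iter (outer (fpos f)) next f = f,
      (label (val f) < outer (fpos f))%N & fpos f \in positions].
Proof.
have iterE j : val (iter j next f) = iter j next_raw (val f).
  by elim: j => //= j ->.
have := facelet_all facelet_facts f; cbv beta.
move=> /and5P[_ /eqP ? /eqP ? /eqP fi /and3P[? _ ?]].
by split=> //; apply: val_inj; rewrite iterE.
Qed.

Lemma next_inj : injective next.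
Proof.
move=> f g e; have [fE _ fK flt _] := next_facts f; have [gE _ gK _ _] := next_facts g.
rewrite -fK -gK -gE -e fE; case: (outer _) flt => // n _.
by rewrite !iterSr e.
Qed.

Definition spin : {perm facelet} := perm next_inj.

Definition flabel (f : facelet) : nat := label (val f).

Definition cubie (k : nat) : finType :=
  seq_sub [seq p <- positions | outer p == k].

Lemma outer_cubie (k : nat) (c : cubie k) : outer (val c) = k.
Proof. by have := valP c; rewrite mem_filter => /andP[/eqP]. Qed.

Lemma cubieP (k : nat) (f : facelet) :
  outer (fpos f) = k -> exists c : cubie k, fpos f = val c.
Proof.
move=> fk; have [_ _ _ _ fP] := next_facts f.
have fL : fpos f \in [seq p <- positions | outer p == k].
  by rewrite mem_filter fk eqxx.
by exists (SeqSub fL).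
Qed.

Lemma baseP (k : nat) (c : cubie k) : sticker (val c) 0 \in facelets.
Proof.
have := valP c; rewrite mem_filter => /andP[_ cP].
by have /and4P[] := allP position_facts _ cP.
Qed.

Definition base (k : nat) (c : cubie k) : facelet := SeqSub (baseP c).

Lemma fpos_base (k : nat) (c : cubie k) : fpos (base c) = val c.
Proof.
have := valP c; rewrite mem_filter => /andP[_ cP].
by have /and4P[_ /eqP] := allP position_facts _ cP.
Qed.

Lemma flabel_base (k : nat) (c : cubie k) : flabel (base c) = 0%N.
Proof.
have := valP c; rewrite mem_filter => /andP[_ cP].
by have /and4P[_ _ /eqP] := allP position_facts _ cP.
Qed.

Lemma spinX (j : nat) (f : facelet) : (spin ^+ j)%g f = iter j next f.
Proof. by rewrite permX; apply: eq_iter => g; rewrite permE. Qed.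

Lemma fpos_spinX (j : nat) (f : facelet) : fpos ((spin ^+ j)%g f) = fpos f.
Proof.
by rewrite spinX; elim: j => //= j <-; have [->] := next_facts (iter j next f).
Qed.

Lemma fpos_spin (f : facelet) : fpos (spin f) = fpos f.
Proof. exact: (fpos_spinX 1). Qed.

Lemma flabel_lt (f : facelet) : (flabel f < outer (fpos f))%N.
Proof. by have [_ _ _ ->] := next_facts f. Qed.

Lemma flabel_spinX (j : nat) (f : facelet) :
  flabel ((spin ^+ j)%g f) = ((flabel f + j) %% outer (fpos f))%N.
Proof.
elim: j => [|j IH]; first by rewrite perm1 addn0 modn_small ?flabel_lt.
rewrite expgSr permM permE /flabel.
have [_ -> _ _ _] := next_facts ((spin ^+ j)%g f).
by rewrite -/(flabel _) IH fpos_spinX -addn1 modnDml addn1 addnS.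
Qed.

Lemma spin_outer (f : facelet) : (spin ^+ outer (fpos f))%g f = f.
Proof. by rewrite spinX; have [_ _ ->] := next_facts f. Qed.

Lemma spin_mod (j : nat) (f : facelet) :
  (spin ^+ (j %% outer (fpos f)))%g f = (spin ^+ j)%g f.
Proof.
rewrite {2}(divn_eq j (outer (fpos f))) addnC expgD permM.
set g := (spin ^+ _)%g f; have <- : fpos g = fpos f by rewrite fpos_spinX.
elim: (j %/ _)%N => [|i IH]; first by rewrite perm1.
by rewrite mulSn expgD permM spin_outer.
Qed.

(** Cubie and label are coordinates on the facelets. Hence a permutation commuting with [spin] is
    determined by its values on the [base] facelets. *)
Lemma faceletE (k : nat) (c : cubie k) (f : facelet) :
  fpos f = val c -> f = (spin ^+ flabel f)%g (base c).
Proof.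
move=> fc; rewrite spinX; apply: val_inj.
have iterE j g : val (iter j next g) = iter j next_raw (val g).
  by elim: j => //= j ->.
have := facelet_all facelet_facts f; cbv beta.
move=> /and5P[_ _ _ _ /and3P[_ /eqP e _]].
by rewrite iterE -{1}e -/(flabel f) -/(fpos f) fc.
Qed.

Lemma spin_transitive (f g : facelet) :
  fpos f = fpos g -> exists j, g = (spin ^+ j)%g f.
Proof.
move=> fg; have [k fk] : exists k, outer (fpos f) = k by eexists.
have [c fc] := cubieP fk.
rewrite (faceletE (etrans (esym fg) fc)).
exists (outer (fpos f) - flabel f + flabel g)%N.
rewrite [in RHS](faceletE fc) -permM -expgD addnA.
rewrite -(faceletE fc) subnKC ?(ltnW (flabel_lt f)) // expgD permM.
by rewrite fc -fpos_base spin_outer.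
Qed.

(** * The centralizer of the spin *)

Lemma cent_spinX (s : {perm facelet}) (j : nat) (f : facelet) :
  s \in 'C[spin]%g -> s ((spin ^+ j)%g f) = (spin ^+ j)%g (s f).
Proof.
by move=> /cent1P sC; rewrite -!permM; rewrite -(commuteX j sC).
Qed.

Lemma cent_spin_fpos (s : {perm facelet}) (f g : facelet) :
  s \in 'C[spin]%g -> fpos f = fpos g -> fpos (s f) = fpos (s g).
Proof.
by move=> sC /spin_transitive[j ->]; rewrite cent_spinX // fpos_spinX.
Qed.

Lemma cent_spinP (s : {perm facelet}) :
  (forall f, s (spin f) = spin (s f)) -> s \in 'C[spin]%g.
Proof. by move=> H; apply/cent1P/permP => f; rewrite !permM H. Qed.

(** This characterizes [next_raw] by notions that configurations preserve: the same facelet on a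
    center, the other one on an edge, the clockwise successor on a corner. *)
Lemma S_Conf_facts : all (fun h => all (fun g =>
  [&& (outer h.1 == 1%N) ==> (g == h) && (next_raw h == h),
      (outer h.1 == 2%N) ==> (g != h) ==> (g == next_raw h),
      (outer h.1 == 2%N) ==> (next_raw h != h),
      (outer h.1 == 3%N) ==> clockwise h.1 h.2 g.2 ==> (g == next_raw h)
    & (outer h.1 == 3%N) ==> clockwise h.1 h.2 (next_raw h).2])
  [seq g <- facelets | g.1 == h.1]) facelets.
Proof. by vm_compute. Qed.

Lemma outer_fpos (f : facelet) : outer (fpos f) \in [:: 1; 2; 3]%N.
Proof.
have [_ _ _ _ fP] := next_facts f.
by have /and4P[] := allP position_facts _ fP.
Qed.

Lemma S_Conf_cent_spin (s : {perm facelet}) : s \in S_Conf -> s \in 'C[spin]%g.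
Proof.
rewrite inE => /andP[/forallP kind clock]; apply: cent_spinP => f.
have [_ _ _ _ fP] := next_facts f.
have /existsP[p' /andP[/eqP op /eqP im]] := kind (SeqSub fP).
have sE g : fpos g = fpos f -> fpos (s g) = val p'.
  move=> gf; have : s g \in facelets_at (val p').
    by rewrite -im imset_f // inE gf.
  by rewrite inE => /eqP.
have sf := sE f erefl; have ssf := sE (spin f) (fpos_spin f).
have mem g h : fpos g = fpos h -> val g \in [seq g <- facelets | g.1 == (val h).1].
  by move=> e; rewrite mem_filter (valP g) -/(fpos g) e eqxx.
have := allP (facelet_all S_Conf_facts (s f)) _ (mem _ _ (etrans ssf (esym sf))).
cbv beta => /and5P[c1 c2 _ c3 _].
have := allP (facelet_all S_Conf_facts f) _ (mem f f erefl).
cbv beta => /and5P[_ _ d2 _ d3].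
have spinE g : val (spin g) = next_raw (val g) by rewrite permE.
apply: val_inj; rewrite spinE.
have of' : outer (val (s f)).1 = outer (fpos f) by rewrite -/(fpos (s f)) sf -op.
move: c1 c2 c3 d2 d3; rewrite of' -!/(fpos f) => c1 c2 c3 d2 d3.
have := outer_fpos f; rewrite !inE => /or3P[] ok; move: ok c1 c2 c3 d2 d3.
- by move=> -> + _ _ _ _ /= => /andP[/eqP -> /eqP].
- move=> -> _ + _ + _ => /implyP/(_ isT)/implyP c d; apply/eqP/c.
  rewrite val_eqE (inj_eq perm_inj); apply: contraNneq d => e.
  by rewrite -spinE e.
- move=> ok; rewrite ok => _ _ /implyP/(_ isT)/implyP c _ /implyP/(_ isT) d; apply/eqP/c.
  move: clock => /forallP/(_ f)/forallP/(_ (spin f))/implyP.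
  rewrite -/(fpos (s f)) -/(fnormal (s f)) -/(fnormal (s (spin f))); apply.
  rewrite fpos_spin eqxx /= /fnormal spinE d andbT /corners mem_filter fP andbT.
  exact: ok.
Qed.

(** * Lifting permutations of cubies *)

Lemma spinS (j : nat) (f : facelet) : spin ((spin ^+ j)%g f) = (spin ^+ j.+1)%g f.
Proof. by rewrite expgSr permM. Qed.

Lemma spin_mod_base (k : nat) (c : cubie k) (j : nat) :
  (spin ^+ (j %% k))%g (base c) = (spin ^+ j)%g (base c).
Proof. by have := spin_mod j (base c); rewrite fpos_base outer_cubie. Qed.

Definition tracks (k : nat) (s : {perm facelet}) (pi : {perm cubie k}) : Prop :=
  forall c f, fpos f = val c -> fpos (s f) = val (pi c).

Definition lift_fun (k : nat) (pi : {perm cubie k}) (f : facelet) : facelet :=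
  if insub (fpos f) is Some c then (spin ^+ flabel f)%g (base (pi c)) else f.

Lemma lift_fun_base (k : nat) (pi : {perm cubie k}) (c : cubie k) (j : nat) :
  lift_fun pi ((spin ^+ j)%g (base c)) = (spin ^+ j)%g (base (pi c)).
Proof.
rewrite /lift_fun fpos_spinX fpos_base valK flabel_spinX flabel_base add0n.
by rewrite fpos_base outer_cubie spin_mod_base.
Qed.

Lemma lift_fun_out (k : nat) (pi : {perm cubie k}) (f : facelet) :
  outer (fpos f) != k -> lift_fun pi f = f.
Proof. by move=> fk; rewrite /lift_fun insubF // mem_filter (negPf fk). Qed.

Lemma facelet_case (k : nat) (P : facelet -> Prop) :
  (forall (c : cubie k) j, P ((spin ^+ j)%g (base c))) ->
  (forall f, outer (fpos f) != k -> P f) -> forall f, P f.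
Proof.
move=> Pin Pout f; have [/cubieP[c fc]|] := eqVneq (outer (fpos f)) k; last exact: Pout.
by rewrite (faceletE fc).
Qed.

Lemma lift_inj (k : nat) (pi : {perm cubie k}) : injective (lift_fun pi).
Proof.
apply: (can_inj (g := lift_fun pi^-1%g)); apply: (@facelet_case k) => [c j|f fk].
  by rewrite !lift_fun_base permK.
by rewrite !(@lift_fun_out k).
Qed.

Definition lift (k : nat) (pi : {perm cubie k}) : {perm facelet} :=
  perm (@lift_inj k pi).

Lemma lift_base (k : nat) (pi : {perm cubie k}) (c : cubie k) (j : nat) :
  lift pi ((spin ^+ j)%g (base c)) = (spin ^+ j)%g (base (pi c)).
Proof. by rewrite permE lift_fun_base. Qed.

Lemma lift_base0 (k : nat) (pi : {perm cubie k}) (c : cubie k) :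
  lift pi (base c) = base (pi c).
Proof. by have := lift_base pi c 0; rewrite !perm1. Qed.

Lemma lift_out (k : nat) (pi : {perm cubie k}) (f : facelet) :
  outer (fpos f) != k -> lift pi f = f.
Proof. by move=> fk; rewrite permE lift_fun_out. Qed.

Lemma liftM (k : nat) (p q : {perm cubie k}) : lift (p * q)%g = (lift p * lift q)%g.
Proof.
apply/permP; apply: (@facelet_case k) => [c j|f fk].
  by rewrite permM !lift_base permM.
by rewrite permM !(@lift_out k).
Qed.

Lemma lift1 (k : nat) : @lift k 1%g = 1%g.
Proof. by apply: (mulIg (@lift k 1)); rewrite -liftM !mul1g. Qed.

Lemma lift_cent (k : nat) (pi : {perm cubie k}) : lift pi \in 'C[spin]%g.
Proof.
apply: cent_spinP; apply: (@facelet_case k) => [c j|f fk].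
  by rewrite spinS !lift_base spinS.
by rewrite !(@lift_out k) ?fpos_spin.
Qed.

Section LiftPreimage.

Variables (k : nat) (H : {group {perm facelet}}).

(** Lifting is a homomorphism, so this preimage is a group, to which [even_perm_in] applies. *)
Definition lift_preim : {set {perm cubie k}} := [set pi | lift pi \in H].

Lemma group_set_lift_preim : group_set lift_preim.
Proof.
apply/group_setP; split=> [|p q]; first by rewrite inE lift1 group1.
by rewrite !inE liftM; exact: groupM.
Qed.

Canonical lift_preim_group := Group group_set_lift_preim.

End LiftPreimage.

(** * Three-cycles of cubies *)

(** By commutation with [spin], three values settle all stickers of the three cubies. The choice of
    [f] on its cubie records the twist with which that cubie takes part. *)
Definition cycle3 (A B f : facelet) (t : {perm facelet}) : Prop :=
  [/\ t \in 'C[spin]%g, t A = B, t B = f, t f = A &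
      forall g, fpos g \notin [:: fpos A; fpos B; fpos f] -> t g = g].

Lemma cycle3_uniq (A B f : facelet) (t u : {perm facelet}) :
  cycle3 A B f t -> cycle3 A B f u -> t = u.
Proof.
move=> [tC tA tB tf tid] [uC uA uB uf uid]; apply/permP => g.
have [|out] := boolP (fpos g \in [:: fpos A; fpos B; fpos f]); last first.
  by rewrite tid ?uid.
rewrite !inE => /or3P[] /eqP/esym/spin_transitive[j ->];
by rewrite !cent_spinX // ?tA ?tB ?tf ?uA ?uB ?uf.
Qed.

Lemma cycle3J (A B f : facelet) (t g : {perm facelet}) :
  g \in 'C[spin]%g -> cycle3 A B f t -> cycle3 (g A) (g B) (g f) (t ^ g)%g.
Proof.
move=> gC [tC tA tB tf tid]; split; rewrite ?permJ ?tA ?tB ?tf //.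
  by rewrite groupJ.
move=> h; rewrite -[h](permKV g) => hout; rewrite permJ tid //.
apply: contra hout; rewrite !inE => /or3P[] /eqP e;
by rewrite (cent_spin_fpos gC e) eqxx ?orbT.
Qed.

Lemma cycle3_lift (k : nat) (a b c : cubie k) :
  b != a -> c != a -> c != b ->
  cycle3 (base a) (base b) (base c) (lift (tperm a b * tperm a c)%g).
Proof.
move=> ba ca cb; split; rewrite ?lift_base0 ?lift_cent //.
- by rewrite permM tpermL tpermD // eq_sym.
- by rewrite permM tpermR tpermL.
- by rewrite permM (@tpermD _ a b c) 1?eq_sym // tpermR.
move=> g; have [/cubieP[d gd]|?] := eqVneq (outer (fpos g)) k; last by rewrite lift_out.
rewrite !inE !fpos_base gd !val_eqE !negb_or => /and3P[da db dc].
by rewrite (faceletE gd) lift_base permM !tpermD // eq_sym.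
Qed.

(** * Twists of corners *)

Section Twists.

Implicit Types d e : {ffun cubie 3 -> 'Z_3}.

Definition twist_fun d (f : facelet) : facelet :=
  if insub (fpos f) is Some c then (spin ^+ d c)%g f else f.

Lemma twist_fun_in d (c : cubie 3) (f : facelet) :
  fpos f = val c -> twist_fun d f = (spin ^+ d c)%g f.
Proof. by rewrite /twist_fun => ->; rewrite valK. Qed.

Lemma twist_fun_out d (f : facelet) : outer (fpos f) != 3%N -> twist_fun d f = f.
Proof. by move=> fk; rewrite /twist_fun insubF // mem_filter (negPf fk). Qed.

Lemma spin_Zp_add (c : cubie 3) (f : facelet) (i j : 'Z_3) :
  fpos f = val c -> (spin ^+ (i + j)%R)%g f = (spin ^+ j)%g ((spin ^+ i)%g f).
Proof.
move=> fc; rewrite -[RHS]permM -expgD.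
by have := spin_mod (nat_of_ord i + nat_of_ord j) f; rewrite fc outer_cubie => <-.
Qed.

Lemma twist_fun_inj d : injective (twist_fun d).
Proof.
apply: (can_inj (g := twist_fun (- d))) => f.
have [/cubieP[c fc]|fk] := eqVneq (outer (fpos f)) 3%N; last first.
  by rewrite (twist_fun_out _ fk) twist_fun_out.
rewrite (twist_fun_in _ fc) (@twist_fun_in _ c) ?fpos_spinX // -(spin_Zp_add _ _ fc).
by rewrite ffunE subrr perm1.
Qed.

Definition twist d : {perm facelet} := perm (@twist_fun_inj d).

Lemma twist_in d (c : cubie 3) (f : facelet) :
  fpos f = val c -> twist d f = (spin ^+ d c)%g f.
Proof. by move=> fc; rewrite permE (twist_fun_in _ fc). Qed.

Lemma twist_out d (f : facelet) : outer (fpos f) != 3%N -> twist d f = f.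
Proof. by move=> fk; rewrite permE twist_fun_out. Qed.

Lemma twistD d e : twist (d + e) = (twist d * twist e)%g.
Proof.
apply/permP => f; rewrite permM.
have [/cubieP[c fc]|fk] := eqVneq (outer (fpos f)) 3%N; last by rewrite !twist_out.
by rewrite !(@twist_in _ c) ?fpos_spinX // ffunE (spin_Zp_add _ _ fc).
Qed.

Lemma twist0 : twist 0 = 1%g.
Proof. by apply: (mulIg (twist 0)); rewrite -twistD addr0 mul1g. Qed.

Lemma twistMn d n : twist (d *+ n) = (twist d ^+ n)%g.
Proof. by elim: n => [|n IH]; rewrite ?twist0 // mulrS twistD IH expgS. Qed.

Lemma twist_cent d : twist d \in 'C[spin]%g.
Proof.
apply: cent_spinP => f.
have [/cubieP[c fc]|fk] := eqVneq (outer (fpos f)) 3%N; last first.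
  by rewrite !twist_out ?fpos_spin.
by rewrite !(@twist_in _ c) ?fpos_spin // spinS expgS permM.
Qed.

Definition unit_twist (c : cubie 3) : {ffun cubie 3 -> 'Z_3} :=
  [ffun b => if b == c then 1 else 0].

(** The value at [z] is given on [spin (base z)], so that the twist by -1 appears as undoing one
    spin. *)
Lemma twist_diff (x z : cubie 3) (t := twist (unit_twist x - unit_twist z)) :
  x != z ->
  [/\ t (base x) = spin (base x), t (spin (base z)) = base z
    & forall f, fpos f != val x -> fpos f != val z -> t f = f].
Proof.
move=> xz; rewrite {}/t; split=> [||f].
- by rewrite (twist_in _ (fpos_base x)) !ffunE eqxx (negPf xz) subr0 expg1.
- rewrite (@twist_in _ z) ?fpos_spin ?fpos_base // !ffunE eqxx eq_sym (negPf xz).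
  rewrite -{1}[spin]expg1 -(spin_Zp_add 1 _ (fpos_base z)) add0r subrr.
  exact: perm1.
have [/cubieP[b fb]|fk] := eqVneq (outer (fpos f)) 3%N; last by rewrite twist_out.
rewrite (twist_in _ fb) fb !val_eqE !ffunE => /negPf-> /negPf->.
by rewrite subrr perm1.
Qed.

Lemma twist_in_group (H : {group {perm facelet}}) (a : cubie 3) d :
  (forall c, c != a -> twist (unit_twist c - unit_twist a) \in H) ->
  \sum_c d c = 0 -> twist d \in H.
Proof.
move=> Hc d0.
(* At [a] the right-hand side is [d a] minus the sum of all [d c], which vanishes. *)
have -> : d = \sum_c (unit_twist c - unit_twist a) *+ d c.
  apply/ffunP => b; rewrite sum_ffunE.
  under eq_bigr => c _ do rewrite ffunMnE !ffunE mulrnBl.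
  rewrite sumrB (bigD1 b) //= eqxx big1 ?addr0 => [|c /negPf cb]; last first.
    by rewrite eq_sym cb mul0rn.
  have natZ (i : 'Z_3) : 1 *+ i = i by exact: natr_Zp.
  rewrite natZ; case: eqP => _; last by rewrite big1 ?subr0 // => c _; rewrite mul0rn.
  by under eq_bigr => c _ do rewrite natZ; rewrite d0 subr0.
rewrite (big_morph twist twistD twist0) group_prod // => c _.
rewrite twistMn groupX //; have [->|/Hc //] := eqVneq c a.
by rewrite subrr twist0 group1.
Qed.

End Twists.

(* The two twists are t^-1 u and u t^-1. *)
Lemma twist_of_cycle3 (H : {group {perm facelet}}) (a b c : cubie 3) t u :
  b != a -> c != a -> c != b ->
  cycle3 (base a) (base b) (base c) t -> cycle3 (base a) (base b) (spin (base c)) u ->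
  t \in H -> u \in H ->
  twist (unit_twist c - unit_twist a) \in H /\ twist (unit_twist b - unit_twist c) \in H.
Proof.
move=> ba ca cb [tC tA tB tf tid] uP tH uH.
have [wc wa wid] := twist_diff ca.
have bc : b != c by rewrite eq_sym.
have [vb vc vid] := twist_diff bc.
set w := twist _ in wc wa wid *; set v := twist _ in vb vc vid *.
have wb : w (base b) = base b by rewrite wid // fpos_base val_eqE // eq_sym.
have va : v (base a) = base a by rewrite vid // fpos_base val_eqE // eq_sym.
have tspin g : t (spin g) = spin (t g) by have := cent_spinX 1 g tC.
have out g : fpos g \notin [:: fpos (base a); fpos (base b); fpos (spin (base c))] ->
    [/\ t g = g, w g = g & v g = g].
  rewrite fpos_spin => gout; have := gout; rewrite !inE !fpos_base !negb_or.
  by case/and3P => ga gb gc; rewrite tid ?wid ?vid.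
have ut : u = (t * w)%g.
  apply: cycle3_uniq uP _; split; rewrite ?permM ?groupM ?twist_cent //.
  - by rewrite tA.
  - by rewrite tB.
  - by rewrite tspin tf.
  - by move=> g /out[tg wg _]; rewrite permM tg.
have uv : u = (v * t)%g.
  apply: cycle3_uniq uP _; split; rewrite ?permM ?groupM ?twist_cent //.
  - by rewrite va.
  - by rewrite vb tspin tB.
  - by rewrite vc tf.
  - by move=> g /out[tg _ vg]; rewrite permM vg.
by split; [rewrite -(groupMl _ tH) -ut | rewrite -(groupMr _ tH) -uv].
Qed.

(** * Moves *)

Lemma turnE (n : Defs.normal) (c : bool) (f : facelet) :
  val (turn n c f) = turn_raw (val n) c (val f).
Proof. by rewrite permE. Qed.

(** Rotations preserve determinants, hence the clockwise order at corners and the labels on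
    edges. *)
Lemma turn_facts : all (fun n => all (fun c => all (fun f =>
  let g := turn_raw n c f in
  (turn_raw n c (next_raw f) == next_raw g) &&
  (if outer f.1 == 2%N then (outer g.1 == 2%N) && (label g == label f) else true))
  facelets) [:: true; false]) normals.
Proof. by vm_compute. Qed.

Lemma turn_all (P : vec -> bool -> bool) :
  all (fun n => all (P n) [:: true; false]) normals ->
  forall (n : Defs.normal) c, P (val n) c.
Proof. by move=> /allP H n c; have /allP := H _ (valP n); apply; case: c. Qed.

Lemma turn_cent (n : Defs.normal) (c : bool) : turn n c \in 'C[spin]%g.
Proof.
apply: cent_spinP => f; apply: val_inj; rewrite turnE [spin _]permE /=.
have /andP[/eqP-> _] := facelet_all (turn_all turn_facts n c) f.
by rewrite permE /= turnE.
Qed.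

Lemma turn_in_G (n : Defs.normal) (c : bool) : turn n c \in G.
Proof. by rewrite mem_gen //; apply/imsetP; exists (n, c). Qed.

(** The group is finite, so products of turns suffice and inverses need no case. *)
Lemma G_ind (P : {perm facelet} -> Prop) :
  P 1%g -> (forall n c, P (turn n c)) ->
  (forall s t, P s -> P t -> P (s * t)%g) -> forall s, s \in G -> P s.
Proof.
move=> P1 Pt PM s /gen_prodgP[n [t tP ->]]; apply: (big_ind P) => // i _.
by have /imsetP[[m c] _ ->] := tP i.
Qed.

Lemma G_cent (s : {perm facelet}) : s \in G -> s \in 'C[spin]%g.
Proof.
by apply: (@G_ind (fun s => s \in _)) => [|n c|t u];
  [exact: group1|exact: turn_cent|exact: groupM].
Qed.

Definition run (w : seq (vec * bool)) (f : vec * vec) : vec * vec :=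
  foldl (fun g m => turn_raw m.1 m.2 g) f w.

Lemma run_in_G (w : seq (vec * bool)) :
  all (fun m => m.1 \in normals) w ->
  exists2 s, s \in G & forall f, val (s f) = run w (val f).
Proof.
elim: w => [_|[n c] w IH /= /andP[nP /IH[s sG sE]]].
  by exists 1%g => [|f]; rewrite ?group1 ?perm1.
exists (turn (SeqSub nP) c * s)%g => [|f]; first by rewrite groupM ?turn_in_G.
by rewrite permM sE turnE.
Qed.

(** * All three-cycles are reached *)

Definition moves_off (p q : vec) : seq (vec * bool) :=
  [seq m <- [seq (n, c) | n <- normals, c <- [:: true; false]]
  | (dot p m.1 != depth m.2) && (dot q m.1 != depth m.2)].

(** One round of the search for the orbit of a facelet under the turns that do not touch [p] and
    [q]; repetitions are dropped to keep evaluation fast. *)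
Definition grow (p q : vec) (l : seq (vec * vec)) : seq (vec * vec) :=
  foldl (fun l f => if f \in l then l else f :: l) l
    [seq turn_raw m.1 m.2 f | f <- l, m <- moves_off p q].

(* The moves off the cubies of A and B fix these, and conjugate the 3-cycle
   (A B f) to (A B g) when they send f to g. *)
Lemma cycle3_grow (A B f : facelet) t j x :
  t \in G -> cycle3 A B f t ->
  x \in iter j (grow (fpos A) (fpos B)) [:: val f] ->
  exists2 g, val g = x & exists2 u, u \in G & cycle3 A B g u.
Proof.
move=> tG tP; elim: j x => [|j IH] x /=.
  by rewrite inE => /eqP->; exists f => //; exists t.
set l := iter j _ _ in IH *; rewrite /grow; set ys := [seq _ | _ <- _, _ <- _].
have : forall y, y \in ys ->
    exists2 g, val g = y & exists2 u, u \in G & cycle3 A B g u.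
  move=> y /allpairsPdep[z [[n c] [/IH[g <- [u uG uP]]]]].
  rewrite mem_filter => /andP[/andP[An Bn] /allpairsP[[n' c'] []]].
  rewrite /= in An Bn * => nP _ [En Ec] ->; rewrite {n}En {c}Ec in An Bn *.
  pose m := SeqSub nP; exists (turn m c' g); first by rewrite turnE.
  exists (u ^ turn m c')%g; first by rewrite groupJ ?turn_in_G.
  have fixed h : dot (fpos h) n' != depth c' -> turn m c' h = h.
    by move=> hn; apply: val_inj; rewrite turnE /turn_raw ifN.
  by rewrite -{1}(fixed A) // -{1}(fixed B) //; apply: cycle3J (turn_cent _ _) uP.
(* Only the origin of the elements matters now: each entry of the fold comes from [l] or from
   [ys]. *)
clearbody ys; clearbody l; elim: ys l IH => [|y ys IHys] l lP ysP /=; first exact: lP.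
apply: IHys => z; last by move=> zys; apply: ysP; rewrite inE zys orbT.
case: ifP => _; first exact: lP.
by rewrite inE => /predU1P[->|/lP //]; apply: ysP; rewrite mem_head.
Qed.

(** A certificate to be evaluated: the word [w] performs one 3-cycle, and [j] rounds of the search
    from [f] reach all facelets that [all_cycle3] asks for. *)
Definition cycle3_check (w : seq (vec * bool)) (A B f : vec * vec) (k j : nat) : bool :=
  [&& all (fun m => m.1 \in normals) w,
      [&& A \in facelets, B \in facelets & f \in facelets],
      [&& A == sticker A.1 0, B == sticker B.1 0, outer A.1 == k, outer B.1 == k
        & B.1 != A.1],
      [&& run w A == B, run w B == f & run w f == A],
      all (fun g => run w g == g)
        [seq g <- facelets | g.1 \notin [:: A.1; B.1; f.1]]
    & all (fun g => g \in iter j (grow A.1 B.1) [:: f])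
        [seq g <- facelets | [&& outer g.1 == k, g.1 != A.1, g.1 != B.1
                               & if k == 2%N then label g == 0%N else true]]].

(* Edges cannot be flipped in place, hence the restriction on labels. *)
Definition all_cycle3 (k : nat) : Prop :=
  exists a b : cubie k, b != a /\ forall g,
    outer (fpos g) = k -> fpos g != val a -> fpos g != val b ->
    (k = 2%N -> flabel g = 0%N) ->
    exists2 t, t \in G & cycle3 (base a) (base b) g t.

Lemma all_cycle3_check w A B f k j : cycle3_check w A B f k j -> all_cycle3 k.
Proof.
case/and5P => wP /and3P[AP BP fP] /and5P[/eqP A0 /eqP B0 Ak Bk AB].
case/and3P => /eqP wA /eqP wB /eqP wf /andP[/allP wid /allP reach].
have [/eqP Ak' /eqP Bk'] := (Ak, Bk).
have [a aE] := @cubieP k (SeqSub AP) Ak'; have [b bE] := @cubieP k (SeqSub BP) Bk'.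
have baseA : base a = SeqSub AP by apply: val_inj; rewrite /= -aE -A0.
have baseB : base b = SeqSub BP by apply: val_inj; rewrite /= -bE -B0.
have [t tG tE] := run_in_G wP.
have tP : cycle3 (base a) (base b) (SeqSub fP) t.
  rewrite baseA baseB; split; rewrite ?G_cent //; try by apply: val_inj; rewrite tE.
  by move=> g gout; apply: val_inj; rewrite tE; apply/eqP/wid;
    rewrite mem_filter gout (valP g).
exists a, b; split=> [|g gk ga gb g0]; first by rewrite -val_eqE -aE -bE.
have gr : val g \in iter j (grow A.1 B.1) [:: f].
  apply: reach; rewrite mem_filter (valP g) andbT.
  apply/and4P; split; rewrite -?/(fpos g) ?gk //.
  - by rewrite -/(fpos (SeqSub AP)) aE.
  - by rewrite -/(fpos (SeqSub BP)) bE.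
  by case: eqP => // /g0/eqP.
have gr' : val g \in iter j (grow (fpos (base a)) (fpos (base b))) [:: val (SeqSub fP)].
  by rewrite !fpos_base -aE -bE.
by have [h /val_inj-> ] := cycle3_grow tG tP gr'.
Qed.

(* The next three words are X Y X^-1 Y^-1, where e1, e2, - e2 stand for the faces
   R, B, F: here X = C_R C_B C_R^-1 and Y = B^-1. *)
Lemma all_cycle3_centers : all_cycle3 1.
Proof.
(* An inverse turn is spelled as three equal turns; the final number is a number of search rounds
   that suffices. *)
by apply: (@all_cycle3_check
  [:: (e1, true); (e2, true); (e1, true); (e1, true); (e1, true); (e2, false);
      (e2, false); (e2, false); (e1, true); (e2, true); (e2, true); (e2, true);
      (e1, true); (e1, true); (e1, true); (e2, false)]
  ((1, 3, 1), e2) ((-1, 3, 1), e2) ((-3, 1, -1), - e1) 1 5); vm_compute.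
Qed.

(* X = R B R^-1 and Y = C_B^-1. *)
Lemma all_cycle3_edges : all_cycle3 2.
Proof.
by apply: (@all_cycle3_check
  [:: (e1, false); (e2, false); (e1, false); (e1, false); (e1, false); (e2, true);
      (e2, true); (e2, true); (e1, false); (e2, false); (e2, false); (e2, false);
      (e1, false); (e1, false); (e1, false); (e2, true)]
  ((3, 1, 3), e3) ((-3, 1, 3), - e1) ((-1, 3, -3), e2) 2 5); vm_compute.
Qed.

(* X = R B R^-1 and Y = F^2. *)
Lemma all_cycle3_corners : all_cycle3 3.
Proof.
by apply: (@all_cycle3_check
  [:: (e1, false); (e2, false); (e1, false); (e1, false); (e1, false); (- e2, false);
      (- e2, false); (e1, false); (e2, false); (e2, false); (e2, false);
      (e1, false); (e1, false); (e1, false); (- e2, false); (- e2, false)]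
  ((3, 3, 3), e3) ((3, -3, 3), e3) ((-3, -3, -3), - e3) 3 7); vm_compute.
Qed.

Local Opaque label outer.

(** * Invariants of the moves *)

Definition turn_pos (n : vec) (c : bool) (p : vec) : vec :=
  if dot p n == depth c then Defs.rot n p else p.

(** The turn acts on its layer by 4-cycles. Each is written as three transpositions of its first
    member in [layer] with the other members. *)
Definition turn_swaps (n : vec) (c : bool) (k : nat) : seq (vec * vec) :=
  let layer := [seq p <- positions | (outer p == k) && (dot p n == depth c)] in
  let orbit p := [seq iter i (Defs.rot n) p | i <- [:: 1; 2; 3]%N] in
  flatten [seq [seq (p, q) | q <- orbit p]
          | p <- layer & all (fun q => (index p layer <= index q layer)%N) (orbit p)].

(** On corners, edges and centers an external turn has 1, 2, 1 four-cycles and a central turn 0, 1,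
    2. Each four-cycle is odd, whence the parities. *)
Lemma turn_swaps_facts : all (fun n => all (fun c => all (fun k =>
  let l := [seq p <- positions | outer p == k] in
  let ts := turn_swaps n c k in
  [&& all (fun t => [&& t.1 \in l, t.2 \in l & t.1 != t.2]) ts,
      odd (size ts) == (if k == 2%N then c else ~~ c)
    & all (fun p => foldl (@swap vec) p ts == turn_pos n c p) l])
  [:: 1; 2; 3]%N) [:: true; false]) normals.
Proof. by vm_compute. Qed.

Lemma turn_tracks (n : Defs.normal) (c : bool) (k : nat) :
  k \in [:: 1; 2; 3]%N ->
  exists2 pi : {perm cubie k},
    tracks (turn n c) pi & odd_perm pi = (if k == 2%N then c else ~~ c).
Proof.
move=> k3; have /and3P[/perm_of_swaps[pi po piE] /eqP ts_odd /allP tsE] :=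
  allP (turn_all turn_swaps_facts n c) _ k3.
exists pi; last by rewrite po ts_odd.
move=> d f fd; rewrite piE (eqP (tsE _ (valP d))) -fd /fpos turnE /turn_raw /turn_pos.
by case: ifP.
Qed.

Lemma tracks_base (k : nat) (s : {perm facelet}) (pi : {perm cubie k}) c :
  s \in 'C[spin]%g -> tracks s pi ->
  s (base c) = (spin ^+ flabel (s (base c)))%g (base (pi c)).
Proof. by move=> sC st; apply: faceletE; apply: st; rewrite fpos_base. Qed.

Lemma tracksM (k : nat) (s t : {perm facelet}) (p q : {perm cubie k}) :
  tracks s p -> tracks t q -> tracks (s * t)%g (p * q)%g.
Proof. by move=> sp tq c f /sp/tq; rewrite !permM. Qed.

Lemma tracks1 (k : nat) : @tracks k 1%g 1%g.
Proof. by move=> c f; rewrite !perm1. Qed.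

Lemma tracks_uniq (k : nat) (s : {perm facelet}) (p q : {perm cubie k}) :
  tracks s p -> tracks s q -> p = q.
Proof.
move=> sp sq; apply/permP => c; apply: val_inj.
by rewrite -(sp _ _ (fpos_base c)) (sq _ _ (fpos_base c)).
Qed.

Lemma tracksV (k : nat) (s : {perm facelet}) (p : {perm cubie k}) :
  s \in 'C[spin]%g -> tracks s p -> tracks s^-1%g p^-1%g.
Proof.
move=> sC sp c f fc; rewrite -fpos_base -[in RHS](permK s (base _)).
apply: cent_spin_fpos; first by rewrite groupV.
by rewrite (sp _ _ (fpos_base _)) permKV.
Qed.

Definition edge_rigid (s : {perm facelet}) : Prop :=
  forall f, outer (fpos f) = 2%N ->
  outer (fpos (s f)) = 2%N /\ flabel (s f) = flabel f.

Definition twist_sum (s : {perm facelet}) : 'Z_3 :=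
  \sum_(c : cubie 3) (flabel (s (base c)))%:R.

(** The label of a base after [s] and [t] is its label after [s] plus the one that [t] gives to the
    base of the cubie reached; the latter sum is reindexed along [p]. *)
Lemma twist_sumM (s t : {perm facelet}) (p q : {perm cubie 3}) :
  s \in 'C[spin]%g -> t \in 'C[spin]%g -> tracks s p -> tracks t q ->
  twist_sum (s * t)%g = twist_sum s + twist_sum t.
Proof.
move=> sC tC sp tq; rewrite addrC /twist_sum [X in X + _](reindex_inj (@perm_inj _ p)).
rewrite -big_split; apply: eq_bigr => c _ /=.
rewrite permM {1}(tracks_base c sC sp) cent_spinX // flabel_spinX.
by rewrite (tq _ _ (fpos_base _)) outer_cubie Zp_nat_mod // natrD.
Qed.

Lemma twist_sum_facts : all (fun n => all (fun c =>
  (sumn [seq label (turn_raw n c (sticker p 0))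
        | p <- [seq p <- positions | outer p == 3%N]] %% 3 == 0)%N)
  [:: true; false]) normals.
Proof. by vm_compute. Qed.

Lemma positions_uniq : uniq positions.
Proof. by vm_compute. Qed.

Lemma twist_sum_turn (n : Defs.normal) (c : bool) : twist_sum (turn n c) = 0.
Proof.
pose F p : 'Z_3 := (label (turn_raw (val n) c (sticker p 0)))%:R.
have -> : twist_sum (turn n c) = \sum_(d : cubie 3) F (val d).
  by apply: eq_bigr => d _; rewrite /flabel turnE.
rewrite -(big_map val predT F).
(* The sum over the finite type becomes one over the explicit list, where evaluation has been
   done. *)
rewrite (perm_big [seq p <- positions | outer p == 3%N]) /=; last first.
  apply: uniq_perm => [||p].
  - by rewrite (map_inj_uniq val_inj) index_enum_uniq.
  - by rewrite filter_uniq ?positions_uniq.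
  apply/mapP/idP => [[d _ ->]|pP]; first exact: valP d.
  by exists (SeqSub pP); rewrite ?mem_index_enum.
have /eqP := turn_all twist_sum_facts n c; rewrite sumnE big_map => e.
by rewrite -natr_sum -Zp_nat_mod // e.
Qed.

Lemma base_up_down (c : cubie 3) : up_down (fnormal (base c)).
Proof.
have -> : fnormal (base c) = (sticker (val c) 0).2 by [].
move: (val c) (valP c); apply/allP; by vm_compute.
Qed.

Local Opaque spin base turn.

(** These are the three conditions of the theorem in terms of labels, bundled with the cubie
    permutations so that they multiply. *)
Definition lawful (s : {perm facelet}) (sigma : {perm cubie 3})
    (tau : {perm cubie 2}) (rho : {perm cubie 1}) : Prop :=
  [/\ s \in 'C[spin]%g, tracks s sigma, tracks s tau & tracks s rho] /\
  [/\ edge_rigid s, twist_sum s = 0 & odd_perm sigma = odd_perm rho].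

Lemma lawful1 : lawful 1%g 1%g 1%g 1%g.
Proof.
split; first by split; [exact: group1|exact: tracks1|exact: tracks1|exact: tracks1].
split; [by move=> f; rewrite perm1| |by rewrite !odd_perm1].
by rewrite /twist_sum big1 // => c _; rewrite perm1 flabel_base.
Qed.

Lemma lawfulM s sigma tau rho s' sigma' tau' rho' :
  lawful s sigma tau rho -> lawful s' sigma' tau' rho' ->
  lawful (s * s')%g (sigma * sigma')%g (tau * tau')%g (rho * rho')%g.
Proof.
move=> [[sC s3 s2 s1] [sr sw so]] [[tC t3 t2 t1] [tr tw to]]; split.
  by split; [exact: groupM|exact: tracksM|exact: tracksM|exact: tracksM].
split; last by rewrite !odd_permM so to.
  move=> f /sr[sf slab]; rewrite permM; have [tf tlab] := tr _ sf.
  exact: conj tf (etrans tlab slab).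
by rewrite (twist_sumM sC tC s3 t3) sw tw addr0.
Qed.

Lemma lawful_turn (n : Defs.normal) (c : bool) :
  exists sigma tau rho, [/\ lawful (turn n c) sigma tau rho,
    odd_perm sigma = ~~ c & odd_perm tau = c].
Proof.
have [sigma s3 so] := @turn_tracks n c 3 isT.
have [tau s2 to] := @turn_tracks n c 2 isT.
have [rho s1 ro] := @turn_tracks n c 1 isT.
exists sigma, tau, rho; split; [|exact: so|exact: to].
split; split; [exact: turn_cent|exact: s3|exact: s2|exact: s1| | |by rewrite so ro].
  move=> f f2; have /andP[_] := facelet_all (turn_all turn_facts n c) f.
  by rewrite -/(fpos f) f2 eqxx -turnE -/(fpos _) -!/(flabel _) =>
    /andP[/eqP g2 /eqP gl]; exact: conj g2 gl.
exact: twist_sum_turn.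
Qed.

Lemma G_lawful (s : {perm facelet}) :
  s \in G -> exists sigma tau rho, lawful s sigma tau rho.
Proof.
apply: (G_ind (P := fun s => exists sigma tau rho, lawful s sigma tau rho)) => [|n c|].
- by do 3!eexists; exact: lawful1.
- by have [sigma [tau [rho [? _ _]]]] := lawful_turn n c; exists sigma, tau, rho.
move=> t u [? [? [? tl]]] [? [? [? ul]]].
by do 3!eexists; exact: lawfulM tl ul.
Qed.

(** * Sufficiency of the invariants *)

Lemma lift_even (k : nat) (pi : {perm cubie k}) :
  all_cycle3 k -> ~~ odd_perm pi -> lift pi \in G.
Proof.
case=> a [b [ba abP]] even.
suff: pi \in lift_preim_group k G by rewrite inE.
apply: (even_perm_in ba _ even) => c ca cb; rewrite inE.
have [||||t tG tP] := abP (base c); rewrite ?fpos_base ?outer_cubie ?val_eqE //.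
  by rewrite flabel_base.
by rewrite (cycle3_uniq (cycle3_lift ba ca cb) tP).
Qed.

Lemma third_corner : let l := [seq p <- positions | outer p == 3%N] in
  all (fun p => all (fun q => has (fun r => (r != p) && (r != q)) l) l) l.
Proof. by vm_compute. Qed.

Lemma twist_in_G (d : {ffun cubie 3 -> 'Z_3}) : \sum_c d c = 0 -> twist d \in G.
Proof.
have [a [b [ba abP]]] := all_cycle3_corners.
have tw c : c != a -> c != b -> twist (unit_twist c - unit_twist a) \in G /\
    twist (unit_twist b - unit_twist c) \in G.
  move=> ca cb.
  have [||||t tG tP] := abP (base c); rewrite ?fpos_base ?outer_cubie ?val_eqE //.
  have [||||u uG uP] := abP (spin (base c));
    rewrite ?fpos_spin ?fpos_base ?outer_cubie ?val_eqE //.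
  exact: twist_of_cycle3 ba ca cb tP uP tG uG.
apply: (twist_in_group (a := a)) => c ca.
have [->|cb] := eqVneq c b; last by have [] := tw c ca cb.
(* Twisting [b] against [a] goes through a third corner: [b] against it, then it against [a]. *)
have /hasP[p pP /andP[pa pb]] := allP (allP third_corner _ (valP a)) _ (valP b).
have [||ta tb] := tw (SeqSub pP); rewrite -?val_eqE //.
by rewrite -(subrKA (unit_twist (SeqSub pP))) twistD groupM.
Qed.

Lemma lift_off (k l : nat) (pi : {perm cubie k}) (c : cubie l) (j : nat) :
  l != k -> lift pi ((spin ^+ j)%g (base c)) = (spin ^+ j)%g (base c).
Proof. by move=> lk; rewrite lift_out // fpos_spinX fpos_base outer_cubie. Qed.

Lemma twist_off (l : nat) (d : {ffun cubie 3 -> 'Z_3}) (c : cubie l) (j : nat) :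
  l != 3%N -> twist d ((spin ^+ j)%g (base c)) = (spin ^+ j)%g (base c).
Proof. by move=> l3; rewrite twist_out // fpos_spinX fpos_base outer_cubie. Qed.

Lemma twist_base (d : {ffun cubie 3 -> 'Z_3}) (c : cubie 3) (j : nat) :
  twist d ((spin ^+ j)%g (base c)) = (spin ^+ (d c + j))%g (base c).
Proof.
rewrite (@twist_in _ c) ?fpos_spinX ?fpos_base //.
by rewrite -[(spin ^+ d c)%g _]permM -expgD addnC.
Qed.

Lemma lawful_even_in_G s sigma tau rho :
  lawful s sigma tau rho -> ~~ odd_perm sigma -> ~~ odd_perm tau -> s \in G.
Proof.
move=> [[sC s3 s2 s1] [sr sw so]] se te.
pose d : {ffun cubie 3 -> 'Z_3} := [ffun c => (flabel (s (base c)))%:R].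
have dG : twist d \in G.
  by apply: twist_in_G; rewrite -[RHS]sw; apply: eq_bigr => c _; rewrite ffunE.
(* Twist the corners in place, then move each kind of cubie without changing labels. Edges need no
   twist by rigidity, and centers have one label only. *)
suff sE : s = (twist d * lift sigma * lift tau * lift rho)%g.
  rewrite sE; apply: groupM; last by apply: lift_even all_cycle3_centers _; rewrite -so.
  apply: groupM; last exact: lift_even all_cycle3_edges te.
  exact: groupM dG (lift_even all_cycle3_corners se).
have sE k (pi : {perm cubie k}) (c : cubie k) j : tracks s pi ->
    s ((spin ^+ j)%g (base c)) =
    (spin ^+ (flabel (s (base c)) + j))%g (base (pi c)).
  by move=> st; rewrite (cent_spinX _ _ sC) {1}(tracks_base c sC st) expgD permM.
apply/permP => f; rewrite !permM.
have := outer_fpos f; rewrite !inE => /or3P[] /eqP /cubieP[c fc]; rewrite (faceletE fc).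
- rewrite (twist_off d c _ isT) (lift_off sigma c _ isT) (lift_off tau c _ isT).
  rewrite lift_base (sE _ _ _ _ s1); congr ((spin ^+ _)%g _).
  have := flabel_lt (s (base c)); rewrite (s1 _ _ (fpos_base c)) outer_cubie.
  by case: (flabel (s (base c))).
- rewrite (twist_off d c _ isT) (lift_off sigma c _ isT) lift_base.
  rewrite (lift_off rho (tau c) _ isT) (sE _ _ _ _ s2); congr ((spin ^+ _)%g _).
  have [|_ ->] := sr (base c); first by rewrite fpos_base outer_cubie.
  by rewrite flabel_base.
rewrite twist_base lift_base (lift_off tau (sigma c) _ isT).
rewrite (lift_off rho (sigma c) _ isT).
rewrite (sE _ _ _ _ s3) ffunE (@val_Zp_nat 3 isT) modn_small; first exact: erefl.
by have := flabel_lt (s (base c)); rewrite (s3 _ _ (fpos_base c)) outer_cubie.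
Qed.

Lemma e1_normal : e1 \in normals.
Proof. by vm_compute. Qed.

(** A central turn changes the parity of the edges only, an external turn those of corners and
    centers only, so at most one of each reduces to the even case. *)
Lemma lawful_in_G s sigma tau rho : lawful s sigma tau rho -> s \in G.
Proof.
pose n : Defs.normal := SeqSub e1_normal.
have [s1 [t1 [r1 [l1 os1 ot1]]]] := lawful_turn n true.
have [s2 [t2 [r2 [l2 os2 ot2]]]] := lawful_turn n false.
wlog te : s sigma tau rho / ~~ odd_perm tau.
  have [te IH l|te IH l] := boolP (odd_perm tau); last exact: (IH _ _ _ _ te l).
  rewrite -(groupMr s (turn_in_G n true)).
  by apply: IH (lawfulM l l1); rewrite odd_permM te ot1.
move=> l; have [se|se] := boolP (odd_perm sigma); last exact: lawful_even_in_G l se te.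
rewrite -(groupMr s (turn_in_G n false)).
apply: lawful_even_in_G (lawfulM l l2) _ _; first by rewrite odd_permM os2 se.
by rewrite odd_permM ot2 addbF.
Qed.

(** * Reading off the 5-tuple *)

Lemma corner_numberE (f : facelet) :
  outer (fpos f) = 3%N -> corner_number f = (flabel f)%:R.
Proof.
rewrite /corner_number /flabel /fpos; move: (val f) (valP f) => g gP /eqP.
move=> g3; apply/eqP; move: g3; apply/implyP; move: g gP; apply/allP.
by vm_compute.
Qed.

Lemma twist_sumV (s : {perm facelet}) (p : {perm cubie 3}) :
  s \in 'C[spin]%g -> tracks s p -> twist_sum s^-1%g = - twist_sum s.
Proof.
move=> sC sp; apply/eqP; rewrite -addr_eq0 addrC.
rewrite -(twist_sumM sC _ sp (tracksV sC sp)) ?groupV // mulgV.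
by rewrite /twist_sum big1 // => c _; rewrite perm1 flabel_base.
Qed.

(** The number [x c] is the label of the sticker brought to [base c], so the sum is the total twist
    of the inverse of [s]; hence the sign. *)
Lemma sum_corner_number (s : {perm facelet}) (sigma : {perm cubie 3})
    (x : {ffun cubie 3 -> 'Z_3}) :
  s \in 'C[spin]%g -> tracks s sigma ->
  (forall c f, fpos f = val c -> up_down (fnormal f) ->
     x c = corner_number (s^-1%g f)) ->
  \sum_c x c = - twist_sum s.
Proof.
move=> sC ss xP; rewrite -(twist_sumV sC ss); apply: eq_bigr => c _.
rewrite (xP _ _ (fpos_base c) (base_up_down c)) corner_numberE //.
by rewrite (tracksV sC ss (fpos_base c)) outer_cubie.
Qed.

(** The label of the reference facelet: on b-positions the determinant label is opposite to the
    numbering by colours. *)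
Definition shift (t : edge_type) : 'Z_2 := if t is type_a then 0 else 1.

Lemma edge_numberE (f : facelet) :
  outer (fpos f) = 2%N -> edge_number f = (flabel f)%:R + shift (type_of (fpos f)).
Proof.
rewrite /edge_number /flabel /fpos; move: (val f) (valP f) => g gP /eqP.
move=> g2; apply/eqP; move: g2; apply/implyP; move: g gP; apply/allP.
by vm_compute.
Qed.

Lemma reference_label (f : facelet) :
  outer (fpos f) = 2%N -> is_reference (fpos f) (fnormal f) ->
  (flabel f)%:R = shift (type_of (fpos f)).
Proof.
rewrite /flabel /fpos /fnormal; move: (val f) (valP f) => g gP /eqP.
move=> g2 gr; apply/eqP; apply: (implyP _ gr); apply: (implyP _ g2).
have H : all (fun g => (outer g.1 == 2%N) ==> is_reference g.1 g.2 ==>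
    ((label g)%:R == shift (type_of g.1))) facelets by vm_compute.
exact: (allP H _ gP).
Qed.

Lemma delta_shift (t u : edge_type) : 1 - delta t u = shift t + shift u.
Proof. by case: t; case: u; apply/eqP; vm_compute. Qed.

(** For [f] the reference facelet of [p], [y p] is the label of the home of its sticker plus the
    shift of the home type, while [f] has as label the shift of the type of [p]. So the formula for
    [y p] says that the two labels agree. *)
Lemma edge_rigidP (s : {perm facelet}) (tau : {perm edge})
    (y : {ffun edge -> 'Z_2}) :
  s \in 'C[spin]%g -> tracks (k := 2) s tau ->
  (forall c f, fpos f = val c -> is_reference (val c) (fnormal f) ->
     y c = edge_number (s^-1%g f)) ->
  edge_rigid s <-> forall p,
    y p = 1 - delta (type_of (val p)) (type_of (val (tau^-1%g p))).
Proof.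
move=> sC st yP.
have edgeP p : exists f, [/\ fpos f = val p, fpos (s^-1%g f) = val (tau^-1%g p) &
    (y p == 1 - delta (type_of (val p)) (type_of (val (tau^-1%g p)))) =
    (flabel (s^-1%g f) == flabel f)].
  have [f [fp fr _]] := edge_facelet p; exists f.
  have fp' : fpos (s^-1%g f) = val (tau^-1%g p) := tracksV sC st fp.
  have f2 : outer (fpos f) = 2%N by rewrite fp; apply: (@outer_cubie 2).
  have f2' : outer (fpos (s^-1%g f)) = 2%N by rewrite fp'; apply: (@outer_cubie 2).
  split; [exact: fp|exact: fp'|].
  rewrite (yP _ _ fp fr) edge_numberE // fp' delta_shift (inj_eq (addIr _)).
  rewrite -fp -(reference_label f2) ?fp // -val_eqE /= !(@val_Zp_nat 2 isT).
  have := flabel_lt f; rewrite f2 => lf.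
  have := flabel_lt (s^-1%g f); rewrite f2' => lf'.
  by rewrite !modn_small.
split=> [rigid p|yE g g2].
  have [f [fp fp' e]] := edgeP p; apply/eqP; rewrite e.
  have [|_] := rigid (s^-1%g f); first by rewrite fp'; apply: (@outer_cubie 2).
  by rewrite permKV => ->.
have [c gc] := cubieP g2; have [f [fp fp' e]] := edgeP (tau c).
move: e; rewrite yE eqxx => /esym/eqP lf.
(* Agreement is known for the sticker now on the reference facelet; the other sticker of the cubie
   is a spin of it. *)
have [j ->] : exists j, g = (spin ^+ j)%g (s^-1%g f).
  by apply: spin_transitive; rewrite fp' permK gc.
have f2 : outer (fpos f) = 2%N by rewrite fp; apply: (@outer_cubie 2).
have f2' : outer (fpos (s^-1%g f)) = 2%N by rewrite fp'; apply: (@outer_cubie 2).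
rewrite cent_spinX // permKV fpos_spinX; split; first exact: f2.
by rewrite !flabel_spinX f2 f2' lf.
Qed.

Lemma validE (s : {perm facelet}) : valid s = (s \in G).
Proof. by rewrite /valid orbitR lcoset1. Qed.

Theorem theorem3p1 (s : {perm facelet}) (sigma : {perm corner})
    (tau : {perm edge}) (rho : {perm center})
    (x : {ffun corner -> 'Z_3}) (y : {ffun edge -> 'Z_2}) :
  s \in S_Conf ->
  described s sigma tau rho x y ->
  valid s <->
    [/\ (-1) ^+ sigma = (-1) ^+ rho :> int,
        \sum_(i : corner) x i = 0
      & forall p : edge,
          y p = 1 - delta (type_of (val p)) (type_of (val ((tau^-1)%g p)))].
Proof.
move=> /S_Conf_cent_spin sC [h3 h2 h1 hx hy]; rewrite validE.
have sumE := sum_corner_number (sigma := sigma) (x := x) sC h3 hx.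
have rigidE := edge_rigidP sC h2 hy.
split=> [/G_lawful[sigma' [tau' [rho' [[_ s3 _ s1] [sr sw so]]]]]|[sgn sum0 cond]].
  have e3 : sigma = sigma' := tracks_uniq (k := 3) h3 s3.
  have e1 : rho = rho' := tracks_uniq (k := 1) h1 s1.
  split; [by rewrite e3 e1 so| |exact/rigidE].
  by apply: (etrans sumE); rewrite sw oppr0.
apply: (@lawful_in_G s sigma tau rho).
split; [exact: And4 sC h3 h2 h1|apply: And3; first exact/rigidE].
  by apply: oppr_inj; rewrite -sumE sum0 oppr0.
exact: (@Num.Theory.signr_inj int).
Qed.
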